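(* Let $N\ge 2$ and $q\in(0,1]$ be fixed. For any constant $a_d$ with $0<a_d\le\frac{1}{5\binom N2}$, the semi-dynamic policy $\pi^d$ with parameter $a_d$ achieves $\mathbb{E}[Gap^d(T)]\in\mathcal{O}(1)$ as $T\to\infty$.
   Context: Balls-into-bins model: $T$ balls are sequentially allocated into $N\ge 2$ initially empty bins. In each period $t\in\{1,\dots,T\}$ a ball arrives; it has a preferred bin $P(t)$ drawn uniformly at random from $\{1,\dots,N\}$, and it is flexible ($f(t)=1$) with probability $q\in(0,1]$, otherwise $f(t)=0$. All draws are independent across periods and of each other. A policy $\pi$ determines, without anticipating the future, $\omega^\pi(t)\in\{0,1\}$ (whether to exert flexibility in period $t$). If $f(t)\omega^\pi(t)=1$, a flex set $\mathcal F(t)$ of two distinct bins is drawn uniformly at random and the ball is put in the bin of $\mathcal F(t)$ with the smaller current load (ties broken in favour of the smallest index). If $f(t)\omega^\pi(t)=0$ the ball is put in $P(t)$. Let $x_i^\pi(t)$ be the load of bin $i$ at the end of period $t$, $x_i^\pi(0)=0$, and $Gap^\pi(t)=\max_{i}x_i^\pi(t)-t/N$. Semi-dynamic policy $\pi^d$ (superscript $d$) with constant $a_d>0$: it does not flex until the first period $T^\star=\inf\{t: Gap^d(t)\ge \frac{a_d(T-t)q}{N}\}$ and flexes in every period thereafter, i.e. $\omega^d(t)=0$ for $t\le T^\star$ and $\omega^d(t)=1$ for $t>T^\star$. *)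

(* Defs.v *)
(* MathComp / MathComp-Analysis *)
From HB Require Import structures.
From mathcomp Require Import all_boot all_order all_algebra.
From mathcomp Require Import all_classical all_reals all_analysis.
Set Implicit Arguments.
Unset Strict Implicit.
Unset Printing Implicit Defensive.
Import Order.TTheory GRing.Theory Num.Theory.
Local Open Scope classical_set_scope.
Local Open Scope ring_scope.

Definition flexset (N : nat) := {F : {set 'I_N} | #|F| == 2}.

(* The randomness of one period.  A flex set is drawn in every period,
   independently of everything else, but it is only consulted when flexibility
   is exerted; this does not change the law of the loads. *)
Record draw (N : nat) := Draw {
  pref : 'I_N;
  flexible : bool;
  fset : flexset N
}.

Definition loads (N : nat) := {ffun 'I_N -> nat}.

Definition gap (R : realType) (N t : nat) (x : loads N) : R :=
  (\max_(i < N) x i)%N%:R - t%:R / N%:R.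

Definition least_loaded (N : nat) (x : loads N) (F : flexset N) (j : 'I_N) :=
  (j \in sval F) &&
  [forall k in sval F, (x j < x k)%N || (x j == x k) && (j <= k)%N].

(* Exactly one bin is [least_loaded], so the default of [odflt] is never used. *)
Definition destination (N : nat) (x : loads N) (omega : bool) (d : draw N) :
    'I_N :=
  if flexible d && omega
  then odflt (pref d) [pick j | least_loaded x (fset d) j]
  else pref d.

Definition place (N : nat) (x : loads N) (i : 'I_N) : loads N :=
  [ffun j => (x j + (j == i))%N].

(* A non-anticipating policy: omega(t) is computed from the history
   [:: x(0); ...; x(t-1)] of the load vectors. *)
Definition policy (N : nat) := seq (loads N) -> bool.

(* [trajectory pi D t] is [:: x^pi(0); ...; x^pi(t)].  Period t uses the draw
   D t, for t >= 1; D 0 is never used. *)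
Fixpoint trajectory (N : nat) (pi : policy N) (D : nat -> draw N) (t : nat) :
    seq (loads N) :=
  if t is t'.+1 then
    let h := trajectory pi D t' in
    let x := last [ffun=> 0%N] h in
    rcons h (place x (destination x (pi h) (D t)))
  else [:: [ffun=> 0%N]].

Definition load (N : nat) (pi : policy N) (D : nat -> draw N) (t : nat) :
    loads N :=
  last [ffun=> 0%N] (trajectory pi D t).

(* The first period s recorded in the history h at which
   Gap(s) >= a (T - s) q / N, and [size h] if there is none yet. *)
Definition first_hit (R : realType) (N T : nat) (a q : R) (h : seq (loads N)) :
    nat :=
  find (fun s => a * (T%:R - s%:R) * q / N%:R <=
                 gap R s (nth [ffun=> 0%N] h s))
       (iota 0 (size h)).

(* In period t the history h has size t, so this is omega(t) = 1 iff T* < t. *)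
Definition semi_dynamic (R : realType) (N T : nat) (a q : R) : policy N :=
  fun h => (first_hit T a q h < size h)%N.

(* The draws of periods 1, ..., T have the prescribed laws, and these 3T random
   variables are mutually independent: the product rule is required for all
   choices of events, and subfamilies are obtained by taking events [setT]. *)
Record valid_draws (d : measure_display) (Omega : measurableType d)
    (R : realType) (P : probability Omega R) (N : nat) (q : R) (T : nat)
    (D : nat -> Omega -> draw N) : Prop := ValidDraws {
  measurable_pref : forall t, (1 <= t <= T)%N -> forall A : set 'I_N,
    measurable [set w | A (pref (D t w))];
  measurable_flexible : forall t, (1 <= t <= T)%N -> forall B : set bool,
    measurable [set w | B (flexible (D t w))];
  measurable_fset : forall t, (1 <= t <= T)%N -> forall C : set (flexset N),
    measurable [set w | C (fset (D t w))];
  pref_uniform : forall t, (1 <= t <= T)%N -> forall i : 'I_N,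
    P [set w | pref (D t w) = i] = (N%:R^-1)%:E;
  flexible_law : forall t, (1 <= t <= T)%N ->
    P [set w | flexible (D t w) = true] = q%:E;
  fset_uniform : forall t, (1 <= t <= T)%N -> forall F : flexset N,
    P [set w | fset (D t w) = F] = ('C(N, 2)%:R^-1)%:E;
  draws_independent : forall (A : nat -> set 'I_N) (B : nat -> set bool)
      (C : nat -> set (flexset N)),
    P [set w | forall t, (1 <= t <= T)%N ->
         [/\ A t (pref (D t w)), B t (flexible (D t w))
           & C t (fset (D t w))]] =
    (\prod_(1 <= t < T.+1)
       (P [set w | A t (pref (D t w))] *
        P [set w | B t (flexible (D t w))] *
        P [set w | C t (fset (D t w))]))%E
}.

(* Main.v *)
(* Under flexing, a bin [j] that is currently less loaded than [i] receives the
   next ball with probability larger by at least delta = q / 'C(N, 2), because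
   exchanging [i] for [j] turns the flex sets won by [i] into sets won by [j],
   and [j] also wins {i, j}.  With eta = delta / 2 the sum over ordered pairs of
   (1 + eta)^(x_i - x_j) therefore contracts by rho = 1 - delta eta + eta^2 per
   flexing period, up to an additive constant.  When flexing starts with [m]
   periods left, all load differences are at most
   N Gap <= delta (m + 1) / 5 + N, by the choice of [a_d], and the growth
   (1 + eta)^(delta m / 5) is beaten by the contraction rho^m.  So the
   conditional expectation of Gap(T) is bounded uniformly in the state in which
   flexing starts, and the law of that state is irrelevant. *)
Require Import Defs.
From HB Require Import structures.
From mathcomp Require Import all_boot all_order all_algebra.
From mathcomp Require Import all_classical all_reals all_analysis.
From mathcomp Require Import measurable_realfun ring lra zify.
Set Implicit Arguments.
Unset Strict Implicit.
Unset Printing Implicit Defensive.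
Import Order.TTheory GRing.Theory Num.Theory.
Local Open Scope classical_set_scope.
Local Open Scope ring_scope.

(** * The finite probability space of one period *)

(** A copy of the record [draw] that inherits the finite type structure of products, so that
    expectations become finite sums. *)
Definition outcome (N : nat) := ('I_N * bool * flexset N)%type.

Definition draw_of (N : nat) (u : outcome N) : draw N :=
  Draw u.1.1 u.1.2 u.2.

Definition outcome_of (N : nat) (e : draw N) : outcome N :=
  (pref e, flexible e, fset e).

Lemma outcome_ofK (N : nat) : cancel (@outcome_of N) (@draw_of N).
Proof. by case. Qed.

Definition outcome_prob (R : realType) (N : nat) (q : R) (u : outcome N) : R :=
  N%:R^-1 * (if u.1.2 then q else 1 - q) * 'C(N, 2)%:R^-1.

Lemma card_flexset (N : nat) : #|{: flexset N}| = 'C(N, 2).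
Proof.
rewrite card_sig -[in RHS](card_ord N) -card_draws.
by apply: eq_card => F; rewrite !inE.
Qed.

Lemma outcome_prob_ge0 (R : realType) (N : nat) (q : R) (u : outcome N) :
  0 <= q <= 1 -> 0 <= outcome_prob q u.
Proof.
move=> /andP[q0 q1]; rewrite !mulr_ge0 ?invr_ge0 ?ler0n//.
by case: ifP => _; rewrite ?subr_ge0.
Qed.

Lemma sum_outcome (R : realType) (N : nat) (g : outcome N -> R) :
  \sum_u g u = \sum_(i < N) \sum_(b : bool) \sum_F g (i, b, F).
Proof.
rewrite [RHS]pair_big [RHS]pair_big /=.
by apply: eq_bigr => -[[i b] F] _.
Qed.

Lemma sum_outcome_prob (R : realType) (N : nat) (q : R) :
  (2 <= N)%N -> \sum_(u : outcome N) outcome_prob q u = 1.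
Proof.
move=> N2; have C0 : 'C(N, 2)%:R != 0 :> R by rewrite pnatr_eq0 -lt0n bin_gt0.
have N0 : N%:R != 0 :> R by rewrite pnatr_eq0 -lt0n (leq_trans _ N2).
rewrite sum_outcome; under eq_bigr do rewrite big_bool /outcome_prob /=.
rewrite big_split /= !sumr_const card_flexset card_ord -2!mulrnDl.
rewrite -[X in X *+ N]mulr_natr -[LHS]mulr_natr.
by field; rewrite N0 C0.
Qed.

(** * The winner of a flex set, and the bias of flexing towards emptier bins *)

Lemma least_loaded_exists (N : nat) (x : loads N) (F : flexset N) :
  exists j, least_loaded x F j.
Proof.
have [k0 k0F] : exists k, k \in sval F.
  by apply/card_gt0P; rewrite (eqP (svalP F)).
(* Since [k < N], minimising this key is minimising the pair (load, index) lexicographically, which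
   is the tie-breaking rule. *)
pose key (k : 'I_N) := (x k * N + k)%N.
case: (@arg_minnP _ k0 [in sval F] key k0F) => j jF jmin.
exists j; rewrite /least_loaded jF; apply/forall_inP => k kF.
have := jmin k kF; rewrite /key; have := ltn_ord j; have := ltn_ord k => *.
case: (ltngtP (x j) (x k)) => //= [lt_kj|eq_jk]; first by nia.
by move: (jmin k kF); rewrite /key eq_jk leq_add2l.
Qed.

Lemma least_loaded_inj (N : nat) (x : loads N) (F : flexset N) (j k : 'I_N) :
  least_loaded x F j -> least_loaded x F k -> j = k.
Proof.
move=> /andP[jF /forall_inP jP] /andP[kF /forall_inP kP].
have := jP k kF; have := kP j jF => h1 h2; apply: val_inj => /=; lia.
Qed.

Lemma destination_flex (N : nat) (x : loads N) (a k : 'I_N) (F : flexset N) :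
  (destination x true (Draw a true F) == k) = least_loaded x F k.
Proof.
rewrite /destination /=; case: pickP => [j jF|none]; last first.
  by have [j jF] := least_loaded_exists x F; rewrite none in jF.
by apply/eqP/idP => /= [<-//|]; apply: least_loaded_inj.
Qed.

(* Exchanging [i] for [j] in a flex set sends the sets won by [i] injectively to
   sets won by [j], and misses the set [{i, j}], which [j] also wins. *)
Lemma card_least_loaded (N : nat) (x : loads N) (i j : 'I_N) : (x j < x i)%N ->
  (#|[pred F | least_loaded x F i]| < #|[pred F | least_loaded x F j]|)%N.
Proof.
move=> ji; have nij : i != j by apply: contraTneq ji => ->; rewrite ltnn.
pose S k := [set val F | F : flexset N & least_loaded x F k]%SET.
have cS k : #|[pred F | least_loaded x F k]| = #|S k|.
  rewrite /S card_imset; last exact: val_inj.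
  by apply: eq_card => F; rewrite !inE.
rewrite !cS.
pose h (F : {set 'I_N}) := (j |: F :\ i)%SET.
have SP F : F \in S i ->
    [/\ #|F| = 2, i \in F, j \notin F & forall k, k \in F -> (x i <= x k)%N].
  case/imsetP => G; rewrite inE => /andP[iG /forall_inP GP] ->.
  split=> //.
  - exact: eqP (svalP G).
  - by apply: contraTN ji => /GP; lia.
  - by move=> k /GP; lia.
have hS F : F \in S i -> h F \in S j.
  move=> /SP[F2 iF jF FP].
  have hF2 : #|h F| == 2.
    have := cardsD1 i F; rewrite iF F2 => -[cF].
    by rewrite cardsU1 !inE (negPf jF) andbF /= add1n -[#|_|]add0n -cF.
  apply/imsetP; exists (exist _ (h F) hF2) => //.
  rewrite inE /least_loaded /= /h setU11; apply/forall_inP => k.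
  rewrite !inE => /orP[/eqP->|/andP[_ /FP ik]].
    by rewrite eqxx leqnn orbT.
  by rewrite (leq_trans ji ik).
have hinj : {in S i &, injective h}.
  move=> F G /SP[_ iF jF _] /SP[_ iG jG _] FG.
  rewrite -(finset.setD1K iF) -(finset.setD1K iG); congr (_ |: _)%SET.
  have jD (H : {set 'I_N}) : j \notin H -> (h H :\ j = H :\ i)%SET.
    by move=> jH; apply: finset.setU1K; rewrite !inE (negPf jH) andbF.
  by rewrite -(jD _ jF) -(jD _ jG) FG.
rewrite -(card_in_imset hinj); apply/proper_card/fintype.properP; split.
  by apply/fintype.subsetP => _ /imsetP[F FS ->]; exact: hS.
have ij2 : #|[set i; j]%SET| == 2 by rewrite cards2 nij.
exists [set i; j]%SET.
  apply/imsetP; exists (exist (fun F : {set 'I_N} => #|F| == 2) _ ij2) => //.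
  rewrite inE /least_loaded /= !inE eqxx orbT; apply/forall_inP => k.
  by rewrite !inE => /orP[/eqP->|/eqP->]; rewrite ?ji ?eqxx ?leqnn ?orbT.
apply/negP => /imsetP[F FS /finset.setP/(_ i)].
by rewrite !inE eqxx (negPf nij).
Qed.

(** A flexible ball has at least one more flex set leading it to [j] than to [i], by
    [card_least_loaded], and each flex set has probability 1 / 'C(N, 2). An inflexible ball favours
    neither bin. *)
Lemma flex_bias (R : realType) (N : nat) (q : R) (x : loads N) (i j : 'I_N) :
  (2 <= N)%N -> 0 <= q -> (x j < x i)%N ->
  \sum_u outcome_prob q u * ((destination x true (draw_of u) == i)%:R -
                             (destination x true (draw_of u) == j)%:R)
    <= - (q / 'C(N, 2)%:R).
Proof.
move=> N2 q0 ji; rewrite sum_outcome.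
have N0 : (0 < N)%N by rewrite (leq_trans _ N2).
have C0 : (0 : R) < 'C(N, 2)%:R by rewrite ltr0n bin_gt0.
under eq_bigr do rewrite big_bool.
rewrite big_split /=.
(* Inflexible balls go to a uniform bin, so [i] and [j] cancel. *)
have -> : \sum_(a < N) \sum_F outcome_prob q (a, false, F) *
    ((destination x true (draw_of (a, false, F)) == i)%:R -
     (destination x true (draw_of (a, false, F)) == j)%:R) = 0.
  have sum1 (k : 'I_N) : \sum_(a < N) (a == k)%:R = 1 :> R.
    by rewrite (bigD1 k)//= eqxx big1 ?addr0// => a /negPf->.
  rewrite exchange_big big1 //= => F _; rewrite /outcome_prob /destination /=.
  by rewrite -mulr_sumr sumrB !sum1 subrr mulr0.
rewrite addr0.
apply: (@le_trans _ _ (\sum_(a < N) - (q / 'C(N, 2)%:R) * N%:R^-1)); last first.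
  rewrite sumr_const card_ord -[leLHS]mulr_natr -mulrA mulVf ?mulr1//.
  by rewrite pnatr_eq0 -lt0n.
apply: ler_sum => a _.
under eq_bigr do rewrite !destination_flex /outcome_prob /=.
rewrite -mulr_sumr sumrB.
have cnt k : \sum_F (least_loaded x F k)%:R =
    #|[pred F | least_loaded x F k]|%:R :> R.
  rewrite -sum1_card natr_sum [RHS]big_mkcond /=; apply: eq_bigr => F _.
  by rewrite inE; case: ifP.
rewrite !cnt.
have : #|[pred F | least_loaded x F i]|.+1%:R <=
    #|[pred F | least_loaded x F j]|%:R :> R.
  by rewrite ler_nat card_least_loaded.
rewrite -natr1 => card_ij.
have -> : N%:R^-1 * q * 'C(N, 2)%:R^-1 = q / 'C(N, 2)%:R / N%:R by ring.
rewrite [leRHS](_ : _ = q / 'C(N, 2)%:R / N%:R * (-1)); last by ring.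
by apply: ler_wpM2l; [rewrite !mulr_ge0 ?invr_ge0 ?ler0n | lra].
Qed.

(** * The exponential potential and its drift under flexing *)

(** The subtraction is truncated: an ordered pair with [x i <= x j] contributes exactly 1. *)
Definition potential (R : realType) (N : nat) (eta : R) (x : loads N) : R :=
  \sum_i \sum_j (1 + eta) ^+ (x i - x j)%N.

Lemma place_pair (N : nat) (x : loads N) (i j k : 'I_N) :
  (place x k i - place x k j = (x i + (k == i)) - (x j + (k == j)))%N.
Proof. by rewrite !ffunE !(eq_sym k). Qed.

(** The term is multiplied by 1 + eta, 1 / (1 + eta) or 1 according to whether the ball hits [i],
    [j] or neither. Using 1 / (1 + eta) <= 1 - eta + eta^2 and granting eta^2 in all cases makes the
    bound affine in the indicators, ready for averaging. *)
Lemma pair_place_le (R : realType) (N : nat) (eta : R) (x : loads N)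
    (i j k : 'I_N) : 0 <= eta -> (x j < x i)%N ->
  (1 + eta) ^+ (place x k i - place x k j)%N <=
  (1 + eta) ^+ (x i - x j)%N *
    (1 + eta ^+ 2 + eta * ((k == i)%:R - (k == j)%:R)).
Proof.
move=> eta0 ji; rewrite place_pair.
have e1 : 0 <= (1 + eta) ^+ (x i - x j) by rewrite exprn_ge0 ?addr_ge0.
case: (eqVneq k i) => [->|ki]; case: (eqVneq _ j) => [kj|kj] /=.
- by rewrite kj ltnn in ji.
- rewrite addn0 -addnBAC ?(ltnW ji)// addn1 exprSr subr0 mulr1.
  by apply: ler_wpM2l => //; have := sqr_ge0 eta; lra.
- have -> : (x i - x j)%N = (x i + 0 - (x j + 1)).+1 by lia.
  set n := (_ - _)%N; rewrite exprSr -mulrA ler_peMr ?exprn_ge0 ?addr_ge0//.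
  have : 0 <= eta ^+ 3 by rewrite exprn_ge0.
  have -> : (1 + eta) * (1 + eta ^+ 2 + eta * (0 - 1)) = 1 + eta ^+ 3 by ring.
  by lra.
- by rewrite !addn0 subrr mulr0 addr0 ler_peMr// lerDl sqr_ge0.
Qed.

Lemma pair_place_le1 (R : realType) (N : nat) (eta : R) (x : loads N)
    (i j k : 'I_N) : 0 <= eta -> (x i <= x j)%N ->
  (1 + eta) ^+ (place x k i - place x k j)%N <= 1 + eta.
Proof.
move=> eta0 ij; rewrite place_pair -[leRHS]expr1 ler_weXn2l ?lerDl//.
by case: eqVneq; case: eqVneq => /=; lia.
Qed.

(** If [x j < x i], averaging [pair_place_le] and applying [flex_bias] gives the contraction.
    Otherwise the exponent rises from 0 to at most 1, which the additive 1 + eta pays for. *)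
Lemma pair_drift (R : realType) (N : nat) (q eta : R) (x : loads N)
    (i j : 'I_N) (delta := q / 'C(N, 2)%:R) :
  (2 <= N)%N -> 0 <= q <= 1 -> 0 <= eta -> 0 <= 1 - delta * eta + eta ^+ 2 ->
  \sum_u outcome_prob q u *
     (1 + eta) ^+ (place x (destination x true (draw_of u)) i -
                   place x (destination x true (draw_of u)) j)%N <=
  (1 - delta * eta + eta ^+ 2) * (1 + eta) ^+ (x i - x j)%N + (1 + eta).
Proof.
move=> N2 q01 eta0 rho0; have p0 u := @outcome_prob_ge0 R N q u q01.
case: (ltnP (x j) (x i)) => [ji|ij]; last first.
  apply: (@le_trans _ _ (1 + eta)); last first.
    by rewrite lerDr mulr_ge0// exprn_ge0// addr_ge0.
  rewrite -[leRHS]mul1r -[X in _ <= X * _](sum_outcome_prob q N2) mulr_suml.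
  apply: ler_sum => u _; apply: ler_wpM2l; first exact: p0.
  exact: pair_place_le1.
rewrite -[leLHS]addr0 lerD ?addr_ge0//.
set B := (1 + eta) ^+ (x i - x j).
have B0 : 0 <= B by rewrite exprn_ge0 ?addr_ge0.
apply: (@le_trans _ _ (\sum_u outcome_prob q u * (B * (1 + eta ^+ 2 + eta *
   ((destination x true (draw_of u) == i)%:R -
    (destination x true (draw_of u) == j)%:R))))).
  apply: ler_sum => u _; apply: ler_wpM2l; first exact: p0.
  exact: pair_place_le.
under eq_bigr => u _ do rewrite mulrCA mulrDr [_ * (eta * _)]mulrCA.
rewrite -mulr_sumr big_split /= -mulr_suml sum_outcome_prob// mul1r -mulr_sumr.
rewrite mulrC ler_wpM2r//.
have /andP[q0 _] := q01.
have := ler_wpM2l eta0 (flex_bias N2 q0 ji); rewrite -/delta; lra.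
Qed.

Lemma potential_drift (R : realType) (N : nat) (q eta : R) (x : loads N)
    (delta := q / 'C(N, 2)%:R) :
  (2 <= N)%N -> 0 <= q <= 1 -> 0 <= eta -> 0 <= 1 - delta * eta + eta ^+ 2 ->
  \sum_u outcome_prob q u *
     potential eta (place x (destination x true (draw_of u))) <=
  (1 - delta * eta + eta ^+ 2) * potential eta x + N%:R ^+ 2 * (1 + eta).
Proof.
move=> N2 q01 eta0 rho0; rewrite /potential.
under eq_bigr => u _ do rewrite mulr_sumr.
rewrite exchange_big /=.
have -> : N%:R ^+ 2 * (1 + eta) = \sum_(i < N) \sum_(j < N) (1 + eta).
  by rewrite -natrX mulr_natl !sumr_const card_ord -mulrnA mulnn.
rewrite mulr_sumr -big_split /=; apply: ler_sum => i _.
under eq_bigr => u _ do rewrite mulr_sumr.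
rewrite exchange_big /= mulr_sumr -big_split /=; apply: ler_sum => j _.
exact: pair_drift.
Qed.

Lemma potential_decay (R : realType) (N : nat) (delta : R) (x : loads N)
    (m : nat) (eta := delta / 2) :
  0 <= delta <= 1 ->
  (forall i j, (x i - x j)%N%:R <= delta * m.+1%:R / 5 + N%:R) ->
  (1 - delta * eta + eta ^+ 2) ^+ m * potential eta x <=
    N%:R ^+ 2 * expR (eta * (delta / 5 + N%:R)).
Proof.
move=> /andP[d0 d1] dx; rewrite /potential.
have eta0 : 0 <= eta by rewrite /eta divr_ge0.
have -> : N%:R ^+ 2 * expR (eta * (delta / 5 + N%:R)) =
    \sum_(i < N) \sum_(j < N) expR (eta * (delta / 5 + N%:R)).
  by rewrite -natrX mulr_natl !sumr_const card_ord -mulrnA mulnn.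
rewrite mulr_sumr; apply: ler_sum => i _.
rewrite mulr_sumr; apply: ler_sum => j _.
set k := (x i - x j)%N; have := dx i j; rewrite -/k => {}dx.
have rho0 : 0 <= 1 - delta * eta + eta ^+ 2 by rewrite /eta; nra.
apply: (@le_trans _ _ (expR (m%:R * (- (delta * eta) + eta ^+ 2)) *
  expR (k%:R * eta))).
  rewrite !expRM_natl; apply: ler_pM.
  - exact: exprn_ge0.
  - by rewrite exprn_ge0 ?addr_ge0.
  - by apply: lerXn2r; rewrite ?nnegrE ?expR_ge0// -addrA expR_ge1Dx.
  - by apply: lerXn2r; rewrite ?nnegrE ?expR_ge0 ?addr_ge0// expR_ge1Dx.
rewrite -expRD ler_expR.
have m0 : 0 <= m%:R * (delta * eta) by rewrite !mulr_ge0.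
have := ler_wpM2l eta0 dx; rewrite -natr1.
have eta2 : eta ^+ 2 = delta * eta / 2 by rewrite /eta; field.
by rewrite eta2; lra.
Qed.

(** * The gap compared with load differences and with the potential *)

Lemma sum_le_max (N : nat) (x : loads N) :
  (\sum_i x i <= N * \max_(i < N) x i)%N.
Proof.
rewrite -[X in (_ <= X * _)%N]card_ord -sum_nat_const.
by apply: leq_sum => i _; exact: leq_bigmax.
Qed.

Lemma gap_ge0 (R : realType) (N : nat) (x : loads N) :
  (0 < N)%N -> 0 <= gap R (\sum_i x i)%N x.
Proof.
move=> N0; rewrite /gap subr_ge0 ler_pdivrMr ?ltr0n// -natrM ler_nat mulnC.
exact: sum_le_max.
Qed.

(** With the total load as time, [N] times the gap is the sum over all bins of their deficits below
    the maximum load. The deficit of [j] alone is at least [x i - x j]. *)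
Lemma diff_le_gap (R : realType) (N : nat) (x : loads N) (i j : 'I_N) :
  (x i - x j)%N%:R <= N%:R * gap R (\sum_i x i)%N x.
Proof.
have N0 : (0 < N)%N by rewrite (leq_ltn_trans _ (ltn_ord i)).
rewrite /gap mulrBr [X in _ - X]mulrCA divff ?mulr1 ?pnatr_eq0 -?lt0n//.
rewrite lerBrDr -natrM -natrD ler_nat.
set M := (\max_(_ < _) _)%N.
have : (\sum_(k < N | k != j) x k <= N.-1 * M)%N.
  rewrite -[N in N.-1]card_ord -(cardC1 j) -sum_nat_const.
  by apply: leq_sum => k _; exact: leq_bigmax.
have [iM jM] : (x i <= M)%N /\ (x j <= M)%N by split; exact: leq_bigmax.
have NM : (N * M = M + N.-1 * M)%N by rewrite -mulSn prednK.
move=> rest; rewrite [X in (_ + X <= _)%N](bigD1 j)//= NM addnA leq_add//; lia.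
Qed.

(** For a fullest bin [i], [N] times the gap is the sum over [j] of [x i - x j], and eta k <= (1 +
    eta)^k bounds it by row [i] of the potential. The factor [N >= 1] and the other rows are given
    away. *)
Lemma gap_le_potential (R : realType) (N : nat) (eta : R) (x : loads N) :
  (0 < N)%N -> 0 < eta ->
  gap R (\sum_i x i)%N x <= eta^-1 * potential eta x.
Proof.
move=> N0 eta0; have [i Mi] : {i | \max_(i < N) x i = x i}%N.
  by apply: bigop.eq_bigmax; rewrite card_ord.
rewrite /gap Mi -(ler_pM2l (_ : 0 < N%:R))//; last by rewrite ltr0n.
rewrite mulrBr [X in _ - X]mulrCA divff ?mulr1 ?pnatr_eq0 -?lt0n//.
rewrite -natrM.
have -> : (N * x i)%:R - (\sum_j x j)%N%:R = \sum_j (x i - x j)%N%:R :> R.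
  rewrite -natr_sum; apply/eqP; rewrite subr_eq -natrD -big_split /= eqr_nat.
  rewrite -[X in (X * _)%N]card_ord -sum_nat_const; apply/eqP.
  by apply: eq_bigr => j _; rewrite subnK// -Mi leq_bigmax.
have pos k j : 0 <= (1 + eta) ^+ (x k - x j).
  by rewrite exprn_ge0// addr_ge0// ltW.
have P0 : 0 <= potential eta x by apply: sumr_ge0 => k _; apply: sumr_ge0.
apply: (@le_trans _ _ (eta^-1 * potential eta x)); last first.
  by rewrite ler_peMl ?ler1n// mulr_ge0// invr_ge0 ltW.
rewrite /potential [X in _ <= _ * X](bigD1 i)//= mulrDr.
rewrite -[leLHS]addr0 lerD//; last first.
  rewrite mulr_ge0 ?invr_ge0 ?(ltW eta0)// !sumr_ge0// => k _.
  by rewrite sumr_ge0.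
rewrite mulr_sumr; apply: ler_sum => j _.
rewrite ler_pdivlMl//; elim: (x i - x j)%N => [|k IHk]; first by rewrite mulr0.
rewrite exprS mulrDl mul1r -natr1 mulrDr mulr1 lerD// ler_peMr ?(ltW eta0)//.
by rewrite exprn_ege1// lerDl ltW.
Qed.

(** * Supermartingale bounds as finite sums over tuples *)

Lemma sum_tuple_cons (R : nmodType) (X : finType) (m : nat)
    (g : seq X -> R) :
  \sum_(s : m.+1.-tuple X) g s = \sum_u \sum_(s : m.-tuple X) g (u :: s).
Proof.
rewrite pair_big /=.
rewrite (reindex (fun p : X * m.-tuple X => [tuple of p.1 :: p.2])) //=.
exists (fun s => (thead s, [tuple of behead s])) => [[u s] _|s _] /=.
  by rewrite theadE; congr (_, _); apply: val_inj.
by rewrite -tuple_eta.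
Qed.

(* [m] counts the steps that remain. *)
Lemma supermartingale_tuple (R : realType) (X : finType) (H : Type)
    (p : X -> R) (step : H -> X -> H) (I : nat -> H -> Prop)
    (W : nat -> H -> R) (f : H -> R) :
  (forall u, 0 <= p u) ->
  (forall m h u, I m.+1 h -> I m (step h u)) ->
  (forall m h, I m.+1 h -> \sum_u p u * W m (step h u) <= W m.+1 h) ->
  (forall h, I 0 h -> f h <= W 0 h) ->
  forall m h, I m h ->
    \sum_(s : m.-tuple X) (\prod_(u <- s) p u) * f (foldl step h s) <= W m h.
Proof.
move=> p0 Istep Wstep fW; elim=> [|m IHm] h Ih.
  rewrite (big_pred1 [tuple]) => [|s]; last by rewrite [s]tuple0 /= eq_refl.
  by rewrite big_nil mul1r fW.
rewrite (sum_tuple_cons _ (fun s => (\prod_(u <- s) p u) * f (foldl step h s))).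
apply: le_trans (Wstep m h Ih); apply: ler_sum => u _ /=.
under eq_bigr => s _ do rewrite big_cons -mulrA.
by rewrite -mulr_sumr ler_wpM2l// IHm//; exact: Istep.
Qed.

(** * The process as a chain on histories *)

(** The state is the whole history, because a policy may read all of it. *)
Definition step (N : nat) (pi : policy N) (h : seq (loads N)) (u : outcome N) :=
  let x := last [ffun=> 0%N] h in
  rcons h (place x (destination x (pi h) (draw_of u))).

Lemma trajectory_foldl (N : nat) (pi : policy N) (D : nat -> draw N) (t : nat) :
  trajectory pi D t =
  foldl (step pi) [:: [ffun=> 0%N]] (mkseq (fun i => outcome_of (D i.+1)) t).
Proof.
elim: t => // t IHt; rewrite mkseqS foldl_rcons -IHt /step /=.
by rewrite outcome_ofK.
Qed.

(* [h] is a possible history with [m] periods left out of [T]. *)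
Definition history (N T m : nat) (h : seq (loads N)) :=
  [/\ (0 < size h)%N, (size h + m = T.+1)%N &
      (\sum_i last [ffun=> 0%N] h i)%N = (size h).-1].

Lemma history0 (N T : nat) : history T T [:: [ffun=> 0%N] : loads N].
Proof. by split => //=; rewrite big1// => i _; rewrite ffunE. Qed.

Lemma sum_place (N : nat) (x : loads N) (k : 'I_N) :
  (\sum_i place x k i = (\sum_i x i).+1)%N.
Proof.
under eq_bigr do rewrite ffunE.
rewrite big_split /= -addn1; congr addn.
by rewrite (bigD1 k)//= eqxx big1 => [|i /negPf->].
Qed.

Lemma history_step (N T m : nat) (pi : policy N) (h : seq (loads N))
    (u : outcome N) :
  history T m.+1 h -> history T m (step pi h u).
Proof.
case=> h0 hm sh; split; rewrite ?size_rcons//= ?last_rcons.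
  by rewrite -hm addSnnS.
by rewrite sum_place sh prednK.
Qed.

Lemma history_foldl (N T : nat) (pi : policy N) (s : seq (outcome N))
    (h : seq (loads N)) :
  history T (size s) h -> history T 0 (foldl (step pi) h s).
Proof. by elim: s h => //= u s IHs h hist; apply/IHs/history_step. Qed.

Lemma gap_history (R : realType) (N T : nat) (h : seq (loads N))
    (x := last [ffun=> 0%N] h) :
  history T 0 h -> gap R T x = gap R (\sum_i x i)%N x.
Proof. by case=> _ hT ->; rewrite -[T]/(T.+1.-1) -hT addn0. Qed.

Lemma gap_history_ge0 (R : realType) (N T : nat) (h : seq (loads N)) :
  (0 < N)%N -> history T 0 h -> 0 <= gap R T (last [ffun=> 0%N] h).
Proof. by move=> N0 /gap_history->; exact: gap_ge0. Qed.

(** * The switching rule *)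

Lemma semi_dynamicE (R : realType) (N T : nat) (a q : R) (h : seq (loads N)) :
  semi_dynamic T a q h =
  has (fun s => a * (T%:R - s%:R) * q / N%:R <=
                gap R s (nth [ffun=> 0%N] h s)) (iota 0 (size h)).
Proof. by rewrite /semi_dynamic /first_hit has_find size_iota. Qed.

(** A hit stays recorded in every longer history, so flexing never stops once begun. *)
Lemma semi_dynamic_rcons (R : realType) (N T : nat) (a q : R)
    (h : seq (loads N)) (x : loads N) :
  semi_dynamic T a q h -> semi_dynamic T a q (rcons h x).
Proof.
rewrite !semi_dynamicE => /hasP[s]; rewrite mem_iota add0n /= => sh hit.
apply/hasP; exists s; first by rewrite mem_iota size_rcons add0n /= ltnS ltnW.
by rewrite nth_rcons sh.
Qed.

(** The contrapositive is what controls the switch: as long as the policy does not flex, the current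
    gap is below the threshold. *)
Lemma semi_dynamic_last (R : realType) (N T m : nat) (a q : R)
    (h : seq (loads N)) : history T m h ->
  a * m%:R * q / N%:R <= gap R (size h).-1 (last [ffun=> 0%N] h) ->
  semi_dynamic T a q h.
Proof.
case=> h0 hm _ hit; rewrite semi_dynamicE; apply/hasP; exists (size h).-1.
  by rewrite mem_iota /= add0n prednK.
rewrite nth_last (_ : T%:R - _ = m%:R)//; apply/eqP.
by rewrite subr_eq -natrD eqr_nat; lia.
Qed.

Lemma gap_place (R : realType) (N t : nat) (x : loads N) (k : 'I_N) :
  gap R t.+1 (place x k) <= gap R t x + 1.
Proof.
rewrite /gap -addrAC lerD//.
  rewrite natr1 ler_nat; apply/bigmax_leqP => i _; rewrite ffunE -addn1.
  by rewrite leq_add ?leq_bigmax ?leq_b1.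
by rewrite lerN2 ler_wpM2r ?invr_ge0 ?ler0n// ler_nat.
Qed.

(** * A value function bounding the conditional expectation of the final gap *)

Section Value.
Variables (R : realType) (N T : nat) (q a : R).
Hypotheses (N2 : (2 <= N)%N) (q01 : 0 < q <= 1).
Hypothesis (a_le : a <= 1 / (5 * 'C(N, 2)%:R)).

Let delta := q / 'C(N, 2)%:R.
Let eta := delta / 2.
Let rho := 1 - delta * eta + eta ^+ 2.
Let level := N%:R ^+ 2 * (1 + eta) / (1 - rho).
(** The first summand is the bound of [potential_decay] on what is left, at the end, of the
    potential present at the switch. *)
Let cap := N%:R ^+ 2 * expR (eta * (delta / 5 + N%:R)) + level.

Let C1 : 1 <= 'C(N, 2)%:R :> R.
Proof. by rewrite ler1n bin_gt0. Qed.

Let delta_gt0 : 0 < delta.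
Proof. by case/andP: q01 => q0 _; rewrite divr_gt0// (lt_le_trans _ C1). Qed.

Let delta_le1 : delta <= 1.
Proof.
case/andP: q01 => _ q1; rewrite ler_pdivrMr ?(lt_le_trans _ C1)// mul1r.
exact: le_trans C1.
Qed.

Let eta_gt0 : 0 < eta. Proof. by rewrite divr_gt0. Qed.

Let rho_ge0 : 0 <= rho.
Proof. by rewrite /rho /eta; have := delta_gt0; have := delta_le1; nra. Qed.

Let rho_lt1 : rho < 1.
Proof. by rewrite /rho /eta; have := delta_gt0; nra. Qed.

Let level_ge0 : 0 <= level.
Proof.
apply: divr_ge0; last by rewrite subr_ge0 ltW.
by rewrite mulr_ge0 ?exprn_ge0 ?ler0n ?addr_ge0 ?(ltW eta_gt0).
Qed.

(* [level] is the fixed point of the drift bound y |-> rho y + C of the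
   potential.  After the switch [value] bounds the expected final potential;
   before it, the constant [cap] bounds all values reachable by switching. *)
Let value (m : nat) (h : seq (loads N)) : R :=
  if semi_dynamic T a q h
  then rho ^+ m * (potential eta (last [ffun=> 0%N] h) - level) + level
  else cap.

Let value_step_flex (m : nat) (h : seq (loads N)) : semi_dynamic T a q h ->
  \sum_u outcome_prob q u * value m (step (semi_dynamic T a q) h u) <=
  value m.+1 h.
Proof.
move=> hit; have q01' : 0 <= q <= 1 by case/andP: q01 => /ltW -> ->.
under eq_bigr => u _ do rewrite /value semi_dynamic_rcons// last_rcons hit.
rewrite /value hit; set x := last _ h.
under eq_bigr => u _ do rewrite mulrDr mulrCA mulrBr.
have sum_level : \sum_(u : outcome N) outcome_prob q u * level = level.
  by rewrite -mulr_suml sum_outcome_prob// mul1r.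
rewrite big_split /= -mulr_sumr sumrB !sum_level.
rewrite lerD2r exprSr -mulrA ler_wpM2l ?exprn_ge0//.
have := @potential_drift R N q eta x N2 q01' (ltW eta_gt0) rho_ge0.
rewrite -/delta -/rho.
(* The fixed point equation: measured from [level], the affine drift is a pure contraction by
   [rho]. *)
have : N%:R ^+ 2 * (1 + eta) = (1 - rho) * level.
  by rewrite /level [RHS]mulrC divfK// subr_eq0 gt_eqF.
move=> ->; lra.
Qed.

(** One period earlier the gap was still below its threshold, and one ball raises it by at most 1.
    Hence at the switch all load differences are at most a (m + 1) q + N, as [potential_decay]
    requires. *)
Let value_first_hit (m : nat) (h : seq (loads N)) (u : outcome N) :
  history T m.+1 h -> ~~ semi_dynamic T a q h ->
  value m (step (semi_dynamic T a q) h u) <= cap.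
Proof.
move=> hist nohit; rewrite /value; case: ifP => // _; rewrite last_rcons.
have N0 : 0 < N%:R :> R by rewrite ltr0n (leq_trans _ N2).
have : gap R (size h).-1 (last [ffun=> 0%N] h) < a * m.+1%:R * q / N%:R.
  by rewrite ltNge; apply: contra nohit; exact: semi_dynamic_last.
set x := last _ h; set k := destination _ _ _ => small.
rewrite mulrBr -addrA lerD//; last first.
  by rewrite gerDr oppr_le0 mulr_ge0// exprn_ge0.
apply: potential_decay; first by rewrite (ltW delta_gt0).
move=> i j; apply: le_trans (diff_le_gap _ _ _ _) _.
have [h0 _ sx] := hist.
rewrite sum_place sx.
apply: (@le_trans _ _ (N%:R * (a * m.+1%:R * q / N%:R + 1))).
  rewrite ler_pM2l//; apply: le_trans (gap_place _ _ _ _) _.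
  by rewrite lerD2r ltW.
rewrite mulrDr mulr1 lerD2r mulrCA divff ?gt_eqF// mulr1.
have q0 : 0 <= q by case/andP: q01 => /ltW.
rewrite mulrAC [leRHS]mulrAC ler_wpM2r ?ler0n//.
(* The upper bound on [a] enters here, as a q <= delta / 5. *)
apply: le_trans (ler_wpM2r q0 a_le) _.
rewrite le_eqVlt; apply/orP; left; apply/eqP; rewrite /delta; field.
by rewrite gt_eqF// (lt_le_trans _ C1).
Qed.

Let value_step (m : nat) (h : seq (loads N)) : history T m.+1 h ->
  \sum_u outcome_prob q u * value m (step (semi_dynamic T a q) h u) <=
  value m.+1 h.
Proof.
move=> hist; have [hit|nohit] := boolP (semi_dynamic T a q h).
  exact: value_step_flex.
(* Before the switch the value is the constant [cap], which is rewritten as its own average over the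
   outcomes and compared term by term. *)
rewrite {2}/value (negPf nohit) -[leRHS]mul1r.
rewrite -[X in _ <= X * _](sum_outcome_prob q N2).
rewrite mulr_suml; apply: ler_sum => u _; apply: ler_wpM2l.
  by apply: outcome_prob_ge0; case/andP: q01 => /ltW -> ->.
exact: value_first_hit.
Qed.

(** With no period left the threshold is 0 and the gap is non-negative, so a hit has occurred and
    the value is the potential itself. *)
Let value_end (h : seq (loads N)) : history T 0 h ->
  gap R T (last [ffun=> 0%N] h) <= eta^-1 * value 0 h.
Proof.
move=> hist; have N0 : (0 < N)%N by rewrite (leq_trans _ N2).
rewrite /value (semi_dynamic_last hist) ?expr0 ?mul1r ?subrK; last first.
  rewrite mulr0 !mul0r (le_trans (gap_history_ge0 R N0 hist))//.
  by rewrite (gap_history R hist); case: hist => _ _ ->.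
by rewrite (gap_history R hist) gap_le_potential.
Qed.

Lemma semi_dynamic_tuple_bound : 0 < a -> (0 < T)%N ->
  \sum_(s : T.-tuple (outcome N)) (\prod_(u <- s) outcome_prob q u) *
     gap R T (last [ffun=> 0%N]
       (foldl (step (semi_dynamic T a q)) [:: [ffun=> 0%N]] s)) <=
  eta^-1 * cap.
Proof.
move=> a0 T0; have /andP[q0 q1] := q01.
have N0 : (0 < N)%N by rewrite (leq_trans _ N2).
(* At time 0 the gap is 0, strictly below the threshold a T q / N > 0, so the process starts
   unswitched with value [cap]. *)
have -> : eta^-1 * cap = eta^-1 * value T [:: [ffun=> 0%N]].
  rewrite /value semi_dynamicE /= orbF /gap big1; last first.
    by move=> i _; rewrite ffunE.
  rewrite mul0r !subr0 leNgt ifF//; apply/negbF.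
  by rewrite !mulr_gt0 ?invr_gt0 ?ltr0n.
apply: (@supermartingale_tuple _ _ _ _ (step (semi_dynamic T a q))
  (history T) (fun m h => eta^-1 * value m h)
  (fun h => gap R T (last [ffun=> 0%N] h))).
- by move=> u; rewrite outcome_prob_ge0// (ltW q0).
- by move=> m h u; exact: history_step.
- move=> m h hist; under eq_bigr do rewrite mulrCA.
  by rewrite -mulr_sumr ler_wpM2l ?invr_ge0 ?(ltW eta_gt0)// value_step.
- exact: value_end.
- exact: history0.
Qed.

End Value.

(** * The law of the draws, and expectations as finite sums *)

Definition outcomes_upto (N T : nat) (Omega : Type) (D : nat -> Omega -> draw N)
    (w : Omega) : T.-tuple (outcome N) :=
  [tuple outcome_of (D i.+1 w) | i < T].

Lemma outcomes_uptoE (N T : nat) (Omega : Type) (D : nat -> Omega -> draw N)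
    (w : Omega) :
  outcomes_upto T D w = mkseq (fun i => outcome_of (D i.+1 w)) T :> seq _.
Proof. by rewrite /mkseq -val_enum_ord -map_comp. Qed.

Lemma tuple_size0 (X : Type) (n : nat) (s : n.-tuple X) :
  n = 0%N -> s = [::] :> seq X.
Proof. by move=> n0; apply: size0nil; rewrite size_tuple. Qed.

Section Law.
Context (d : measure_display) (Omega : measurableType d) (R : realType)
  (P : probability Omega R) (N : nat) (q : R) (T : nat)
  (D : nat -> Omega -> draw N).
Hypothesis valid : valid_draws P q T D.

(** Puts the event into the shape of the product rule [draws_independent]. Tuples count from 0 and
    periods from 1, hence [t.-1]; [u0] is the default of [nth]. *)
Lemma outcomes_event (s : T.-tuple (outcome N)) (u0 : outcome N) :
  [set w | outcomes_upto T D w = s] =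
  [set w | forall t, (1 <= t <= T)%N ->
     [/\ [set (nth u0 s t.-1).1.1] (pref (D t w)),
         [set (nth u0 s t.-1).1.2] (flexible (D t w)) &
         [set (nth u0 s t.-1).2] (fset (D t w))]].
Proof.
have nthD w t : (t < T)%N ->
    nth u0 (outcomes_upto T D w) t = outcome_of (D t.+1 w).
  by move=> tT; rewrite outcomes_uptoE nth_mkseq.
apply/seteqP; split => w /=.
  by move=> <- [//|t] /= tT; rewrite nthD.
move=> Ds; apply/val_inj/(@eq_from_nth _ u0); rewrite ?size_tuple// => t tT.
rewrite nthD//; have /= [//|] := Ds t.+1.
by rewrite /outcome_of => -> -> ->; case: nth => -[].
Qed.

Lemma flexible_prob (t : nat) (b : bool) : (1 <= t <= T)%N ->
  P [set w | flexible (D t w) = b] = (if b then q else 1 - q)%:E.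
Proof.
move=> tT; case: b; first exact: (flexible_law valid).
rewrite (_ : [set _ | _] = ~` [set w | flexible (D t w) = true]).
  rewrite probability_setC ?(flexible_law valid)//.
  exact: (measurable_flexible valid tT [set true]).
by apply/seteqP; split => w /=; case: (flexible _).
Qed.

Lemma measurable_outcomes (s : T.-tuple (outcome N)) :
  measurable [set w | outcomes_upto T D w = s].
Proof.
(* For [T = 0] there is only the empty tuple; otherwise the first entry of [s] supplies the default
   [u0]. *)
case: (posnP T) => [T0|T0].
  rewrite (_ : [set _ | _] = setT)//; apply/seteqP; split => w //= _.
  apply: val_inj; exact: etrans (tuple_size0 _ T0) (esym (tuple_size0 _ T0)).
pose u0 := tnth s (Ordinal T0).
rewrite (outcomes_event s u0).
rewrite (_ : [set _ | _] = \bigcap_(t in [set t | (1 <= t <= T)%N])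
   ([set w | [set (nth u0 s t.-1).1.1] (pref (D t w))] `&`
    [set w | [set (nth u0 s t.-1).1.2] (flexible (D t w))] `&`
    [set w | [set (nth u0 s t.-1).2] (fset (D t w))])); last first.
  apply/seteqP; split => w Ds t tT; first by have [] := Ds t tT.
  by have [[]] := Ds t tT.
apply: bigcap_measurableType => t tT.
apply: measurableI; first apply: measurableI.
- exact: (measurable_pref valid tT).
- exact: (measurable_flexible valid tT).
- exact: (measurable_fset valid tT).
Qed.

Lemma outcomes_law (s : T.-tuple (outcome N)) :
  P [set w | outcomes_upto T D w = s] = (\prod_(u <- s) outcome_prob q u)%:E.
Proof.
case: (posnP T) => [T0|T0].
  rewrite (_ : [set _ | _] = setT); last first.
    apply/seteqP; split => w //= _.
    apply: val_inj; exact: etrans (tuple_size0 _ T0) (esym (tuple_size0 _ T0)).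
  by rewrite probability_setT tuple_size0// big_nil.
pose u0 := tnth s (Ordinal T0).
rewrite (outcomes_event s u0).
apply: etrans (draws_independent valid (fun t => [set (nth u0 s t.-1).1.1])
  (fun t => [set (nth u0 s t.-1).1.2]) (fun t => [set (nth u0 s t.-1).2])) _.
rewrite (big_nth u0) size_tuple big_add1 /= -prodEFin.
apply: eq_big_nat => t /andP[_ tT].
have tT1 : (1 <= t.+1 <= T)%N by [].
by rewrite (pref_uniform valid)// (flexible_prob _ tT1) (fset_uniform valid).
Qed.

Lemma expectation_outcomes (G : T.-tuple (outcome N) -> R) :
  (forall s, 0 <= G s) ->
  ('E_P[fun w => G (outcomes_upto T D w)])%E =
  (\sum_(s : T.-tuple (outcome N)) (\prod_(u <- s) outcome_prob q u) * G s)%:E.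
Proof.
move=> G0; rewrite unlock.
pose E s := [set w | outcomes_upto T D w = s].
have mE s : measurable_fun setT (\1_(E s) : Omega -> R).
  by apply/measurable_indic/measurable_outcomes.
(* The variable takes finitely many values, so it is a combination of indicators of the events in
   [outcomes_law]; non-negative weights allow termwise integration. *)
transitivity (\int[P]_w (\sum_(s : T.-tuple (outcome N))
  (G s)%:E * (\1_(E s) w)%:E))%E.
  apply: eq_integral => w _ /=.
  rewrite (bigD1 (outcomes_upto T D w))//= indicE mem_set// mule1.
  rewrite big1 ?adde0// => s /eqP sw.
  by rewrite indicE memNset ?mule0// => /esym.
rewrite ge0_integral_sum//; last first.
- by move=> s w _; rewrite mule_ge0 ?lee_fin// indicE ler0n.
- by move=> s; apply: measurable_funeM; exact/measurable_EFinP.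
rewrite -sumEFin; apply: eq_bigr => s _.
rewrite ge0_integralZl_EFin//; last exact/measurable_EFinP.
rewrite integral_indic ?setIT//; last exact: measurable_outcomes.
by rewrite mulrC EFinM; congr (_ * _)%E; exact: outcomes_law.
Qed.

End Law.

Theorem theorem3 (R : realType) (N : nat) (q a_d : R) :
  (2 <= N)%N -> 0 < q <= 1 -> 0 < a_d <= 1 / (5 * 'C(N, 2)%:R) ->
  exists K : R, \forall T \near \oo,
    forall (d : measure_display) (Omega : measurableType d)
      (P : probability Omega R) (D : nat -> Omega -> draw N),
    valid_draws P q T D ->
    (`| 'E_P[fun w => gap R T
               (load (semi_dynamic T a_d q) (fun t => D t w) T)] | <= K%:E)%E.
Proof.
move=> N2 q01 /andP[a0 a_le]; have N0 : (0 < N)%N by rewrite (leq_trans _ N2).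
have /andP[q0 q1] := q01.
(* [K] is fixed by the last step as [eta^-1 * cap] from [semi_dynamic_tuple_bound]; being introduced
   before [T], it cannot depend on it. *)
eexists; near=> T => d Omega P D valid.
have T0 : (0 < T)%N by near: T; exact: nbhs_infty_gt.
pose pi : policy N := semi_dynamic T a_d q.
pose G (s : T.-tuple (outcome N)) : R :=
  gap R T (last [ffun=> 0%N] (foldl (step pi) [:: [ffun=> 0%N]] s)).
have G0 s : 0 <= G s.
  apply: gap_history_ge0 => //; apply: history_foldl; rewrite size_tuple.
  exact: history0.
have -> : (fun w => gap R T (load pi (fun t => D t w) T)) =
    (fun w => G (outcomes_upto T D w)).
  by apply/funext => w; rewrite /G outcomes_uptoE /load trajectory_foldl.
rewrite (expectation_outcomes valid)// gee0_abs ?lee_fin; last first.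
  apply: sumr_ge0 => s _; rewrite mulr_ge0// prodr_ge0// => u _.
  by rewrite outcome_prob_ge0// (ltW q0).
exact: (semi_dynamic_tuple_bound N2 q01 a_le a0 T0).
Unshelve. all: by end_near.
Qed.
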